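(* Let $\mathcal{O}$ be the ring of an algebroid curve with $r$ minimal primes, and suppose that $\mathcal{O}$ is Gorenstein with semigroup of values $S$. Let $\mathcal{I}$ be a fractional ideal of $\mathcal{O}$ with value set $E$, and let $E^*$ be the value set of its dual $\mathcal{I}^*$. Then for $\beta\in E^*$, $\beta$ is a maximal of $E^*$ if and only if $\mathfrak{f}(S)-\beta\in E$. Moreover, if $\beta\in E^*$ and $\alpha\in E$ are such that $\alpha+\beta=\mathfrak{f}(S)$, then $\alpha$ is an absolute maximal of $E$ if and only if $\beta$ is a relative maximal of $E^*$.
   Context: $\mathbb{N}$ denotes the non-negative integers. The ring of an algebroid curve is a local, reduced, complete $k$-algebra $\mathcal{O}$ of pure dimension one, finitely generated as a complete $k$-algebra (i.e. a quotient of some $k[[X_1,\dots,X_n]]$), where $k$ is an algebraically closed coefficient field of $\mathcal{O}$. Let $\wp_1,\dots,\wp_r$ be its minimal primes, $I=\{1,\dots,r\}$, $\mathcal{O}_i=\mathcal{O}/\wp_i$, and $\mathcal{K}_i$ the fraction field of $\mathcal{O}_i$. The integral closure of $\mathcal{O}_i$ in $\mathcal{K}_i$ is isomorphic to $k[[t_i]]$, so $\mathcal{K}_i\simeq k((t_i))$ with its normalized valuation $v_i$. Let $\mathcal{K}\simeq\mathcal{K}_1\times\cdots\times\mathcal{K}_r$ be the total ring of fractions of $\mathcal{O}$, $\pi_i:\mathcal{K}\to\mathcal{K}_i$ the projections, $Z(\mathcal{K})$ the set of elements of $\mathcal{K}$ with some zero component, $\widetilde{\mathcal{O}}$ the integral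 closure of $\mathcal{O}$ in $\mathcal{K}$, and $v:\mathcal{K}\setminus Z(\mathcal{K})\to\mathbb{Z}^r$, $v(h)=(v_1(\pi_1(h)),\dots,v_r(\pi_r(h)))$. $\mathcal{O}$ is Gorenstein if $\dim_k\mathcal{O}/\mathcal{C}=\dim_k\widetilde{\mathcal{O}}/\mathcal{O}$, where $\mathcal{C}=\{h\in\mathcal{K}: h\widetilde{\mathcal{O}}\subset\mathcal{O}\}$. A fractional ideal of $\mathcal{O}$ is an $\mathcal{O}$-submodule $\mathcal{I}$ of $\mathcal{K}$ containing a regular element of $\mathcal{O}$ and such that $d\,\mathcal{I}\subset\mathcal{O}$ for some regular $d\in\mathcal{O}$. Its value set is $E=v(\mathcal{I}\setminus Z(\mathcal{K}))$; its dual is the fractional ideal $\mathcal{I}^*=\{x\in\mathcal{K}: x\mathcal{I}\subset\mathcal{O}\}$. $S=v(\mathcal{O}\setminus Z(\mathcal{K}))$; with the componentwise order on $\mathbb{Z}^r$, the conductor $c(S)$ is the unique least $\gamma\in S$ with $\gamma+\mathbb{N}^r\subset S$, and $\mathfrak{f}(S)=c(S)-(1,\dots,1)$. For $\emptyset\ne J\subset I$ and $\alpha\in\mathbb{Z}^r$ put $F_J(E,\alpha)=\{\beta\in E:\beta_i=\alpha_i\ \forall i\in J,\ \beta_i>\alpha_i\ \forall i\in I\setminus J\}$ and $F(E,\alpha)=\bigcup_{i\in I}F_{\{i\}}(E,\alpha)$. A point $\alpha\in E$ is a maximal of $E$ if $F(E,\alpha)=\emptyset$. A maximal $\alpha$ is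 an absolute maximal if $F_J(E,\alpha)=\emptyset$ for every $\emptyset\neq J\subset I$ with $J\ne I$; it is a relative maximal if $F_J(E,\alpha)\neq\emptyset$ for every $J\subset I$ with $\#J\ge2$. The same definitions apply to $E^*$. *)

(* Defs.v *)
From HB Require Import structures.
From mathcomp Require Import all_boot all_order all_algebra.
From mathcomp Require Import boolp classical_sets.
Set Implicit Arguments.
Unset Strict Implicit.
Unset Printing Implicit Defensive.
Import Order.TTheory GRing.Theory Num.Theory.
Local Open Scope ring_scope.
Local Open Scope classical_set_scope.

(** * Formal power series *)

(* [fps R] is R[[X]].  It is a record, not an alias of [nat -> R], so that it
   does not inherit the pointwise product of functions. *)
Record fps (R : Type) := Fps { fps_coef : nat -> R }.

HB.instance Definition _ (R : Type) := gen_eqMixin (fps R).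
HB.instance Definition _ (R : Type) := gen_choiceMixin (fps R).

Section FpsRing.
Variable R : comNzRingType.
Implicit Types f g h : fps R.

Lemma fpsP f g : fps_coef f =1 fps_coef g -> f = g.
Proof. by case: f g => [f] [g] /= /funext ->. Qed.

Definition fpsC (c : R) : fps R := Fps (fun n => if n is 0 then c else 0).
Definition fpsX : fps R := Fps (fun n => (n == 1)%:R).
Definition fps_add f g : fps R := Fps (fun n => fps_coef f n + fps_coef g n).
Definition fps_opp f : fps R := Fps (fun n => - fps_coef f n).
Definition fps_mul f g : fps R :=
  Fps (fun n => \sum_(i < n.+1) fps_coef f i * fps_coef g (n - i)%N).

Fact fps_addA : associative fps_add.
Proof. by move=> f g h; apply: fpsP => n /=; rewrite addrA. Qed.
Fact fps_addC : commutative fps_add.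
Proof. by move=> f g; apply: fpsP => n /=; rewrite addrC. Qed.
Fact fps_add0 : left_id (fpsC 0) fps_add.
Proof. by move=> f; apply: fpsP => -[|n] /=; rewrite add0r. Qed.
Fact fps_addN : left_inverse (fpsC 0) fps_opp fps_add.
Proof. by move=> f; apply: fpsP => -[|n] /=; rewrite addNr. Qed.

HB.instance Definition _ := GRing.isZmodule.Build (fps R)
  fps_addA fps_addC fps_add0 fps_addN.

Fact fps_mulC : commutative fps_mul.
Proof.
move=> f g; apply: fpsP => n /=; rewrite (reindex_inj rev_ord_inj) /=.
by apply: eq_bigr => i _; rewrite subSS (subKn (leq_ord i)) mulrC.
Qed.

Fact fps_mulA : associative fps_mul.
Proof.
move=> f g h; apply: fpsP => n.
pose c3 j k := fps_coef f j * (fps_coef g (n - j - k)%N * fps_coef h k).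
have rev p q m : fps_coef (fps_mul p q) m =
    \sum_(i < m.+1) fps_coef p (m - i)%N * fps_coef q i.
  rewrite fps_mulC /=; apply: eq_bigr => i _; exact: mulrC.
rewrite [RHS]rev /=.
transitivity (\sum_(j < n.+1) \sum_(k < n.+1 | (k <= n - j)%N) c3 j k).
  apply: eq_bigr => /= j _; have /= -> := rev g h (n - j)%N.
  by rewrite big_distrr /= (big_ord_narrow_leq (leq_subr _ _)).
rewrite (exchange_big_dep predT) //=; apply: eq_bigr => k _.
transitivity (\sum_(j < n.+1 | (j <= n - k)%N) c3 j k).
  apply: eq_bigl => j; rewrite -ltnS -(ltnS j) -!subSn ?leq_ord //.
  by rewrite -subn_gt0 -(subn_gt0 j) -!subnDA addnC.
rewrite (big_ord_narrow_leq (leq_subr _ _)) big_distrl /=.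
by apply: eq_bigr => j _; rewrite /c3 -!subnDA addnC mulrA.
Qed.

Fact fps_mul1 : left_id (fpsC 1) fps_mul.
Proof.
move=> f; apply: fpsP => n /=; rewrite big_ord_recl /= subn0 mul1r.
by rewrite big1 ?addr0 // => i _; rewrite mul0r.
Qed.

Fact fps_mulDl : left_distributive fps_mul fps_add.
Proof.
move=> f g h; apply: fpsP => n /=; rewrite -big_split /=.
by apply: eq_bigr => i _; rewrite mulrDl.
Qed.

Fact fps_oner_neq0 : fpsC 1 != 0.
Proof.
by apply/eqP => /(congr1 (fun f => fps_coef f 0)) /= /eqP; rewrite oner_eq0.
Qed.

HB.instance Definition _ := GRing.Zmodule_isComNzRing.Build (fps R)
  fps_mulA fps_mulC fps_mul1 fps_mulDl fps_oner_neq0.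

End FpsRing.
Arguments fpsX {R}.

(* R[[X_1, ..., X_n]], built as R[[X_1]]...[[X_n]]. *)
Fixpoint mfps (R : comNzRingType) (n : nat) : comNzRingType :=
  if n is n'.+1 then (fps (mfps R n') : comNzRingType) else R.

Fixpoint mfpsC (R : comNzRingType) (n : nat) : R -> mfps R n :=
  if n is n'.+1 then fun c => fpsC (mfpsC n' c) else id.

(** * Algebroid curves *)

Section Ideals.
Variable O : comNzRingType.
Implicit Types p q : set O.

(* [idealr_closed] includes properness. *)
Definition prime_ideal p : Prop :=
  idealr_closed (mem p) /\ prime_idealr_closed (mem p).

Definition minimal_prime p : Prop :=
  prime_ideal p /\ forall q, prime_ideal q -> q `<=` p -> q = p.

Definition prime_chain p (n : nat) : Prop :=
  exists c : nat -> set O,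
    [/\ forall i, (i <= n)%N -> prime_ideal (c i), p `<=` c 0 &
        forall i, (i < n)%N -> c i `<` c i.+1].

(* The Krull dimension of O/p is n. *)
Definition krull_dim_quot p (n : nat) : Prop :=
  prime_chain p n /\ ~ prime_chain p n.+1.

End Ideals.

(* Completeness needs no separate clause: a quotient of k[[X_1, ..., X_n]] is
   complete for the topology of its maximal ideal. *)
Record algebroid_curve (k : closedFieldType) (O : comUnitAlgType k) : Prop :=
  AlgebroidCurve {
    algebroid_local : forall x y : O,
      x \isn't a GRing.unit -> y \isn't a GRing.unit ->
      x + y \isn't a GRing.unit;
    algebroid_coef_field : forall x : O,
      exists c : k, x - c%:A \isn't a GRing.unit;
    algebroid_reduced : forall (x : O) (n : nat), x ^+ n = 0 -> x = 0;
    algebroid_quotient : exists (n : nat) (phi : {rmorphism mfps k n -> O}),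
      (forall c, phi (mfpsC n c) = c%:A) /\ (forall x, exists f, phi f = x);
    algebroid_pure_dim1 : forall p : set O,
      minimal_prime p -> krull_dim_quot p 1
  }.

Section Curve.
Variables (k : closedFieldType) (O : comUnitAlgType k).

Definition minimal_primes (r : nat) (wp : 'I_r -> set O) : Prop :=
  injective wp /\ forall p, minimal_prime p <-> exists i, wp i = p.

Section TotalFractions.
Variables (K : comUnitAlgType k) (iota : {lrmorphism O -> K}).

Definition total_ring_of_fractions : Prop :=
  [/\ injective iota,
      forall b, GRing.lreg b -> iota b \is a GRing.unit &
      forall x, exists a b, GRing.lreg b /\ x = iota a / iota b].

Definition integral_closure : set K := [set x | integralOver iota x].

(* The conductor ideal {h | h integral_closure \subset O}. *)
Definition conductor_ideal : set K :=
  [set h | forall x, integral_closure x -> range iota (h * x)].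

(* dim_k A/B = n for k-subspaces B \subset A of K: there is a family of n
   elements of A whose classes form a basis of A/B. *)
Definition quot_dim (A B : set K) (n : nat) : Prop :=
  exists e : 'I_n -> K, (forall i, A (e i)) /\
    forall x, A x ->
      exists! c : {ffun 'I_n -> k}, B (x - \sum_(i < n) c i *: e i).

Definition gorenstein : Prop :=
  exists n, quot_dim (range iota) conductor_ideal n /\
            quot_dim integral_closure (range iota) n.

Definition fractional_ideal (I : set K) : Prop :=
  [/\ I 0, forall x y, I x -> I y -> I (x + y),
      forall a x, I x -> I (iota a * x),
      exists2 a, GRing.lreg a & I (iota a) &
      exists2 d, GRing.lreg d & forall x, I x -> range iota (iota d * x)].

Definition dual_ideal (I : set K) : set K :=
  [set x | forall y, I y -> range iota (x * y)].

Section Branches.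
Variables (r : nat) (wp : 'I_r -> set O).
Variables (Ki : 'I_r -> fieldType) (pi : forall i, {rmorphism K -> Ki i}).
Variable tau : forall i, {rmorphism fps k -> Ki i}.

(* [Ki i] is the fraction field of O / wp i, K is the product of the [Ki i]
   with projections [pi i], and [tau i] is an isomorphism of k-algebras from
   k[[t_i]] onto the integral closure of O / wp i in [Ki i]. *)
Record branches : Prop := Branches {
  branch_ker : forall i a, pi i (iota a) = 0 <-> wp i a;
  branch_frac : forall i (y : Ki i), exists a b,
    pi i (iota b) != 0 /\ y = pi i (iota a) / pi i (iota b);
  branch_prod : forall y : (forall i, Ki i), exists! x, forall i, pi i x = y i;
  branch_const : forall i c, tau i (fpsC c) = pi i c%:A;
  branch_inj : forall i, injective (tau i);
  branch_normal : forall i (y : Ki i),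
    integralOver (fun a => pi i (iota a)) y <-> exists f, tau i f = y
}.

(* v_i(y) is the n in Z such that y = u t_i^n with u a unit of k[[t_i]]
   (a power series with nonzero constant term); v_i(0) is irrelevant. *)
Definition branch_val (i : 'I_r) (y : Ki i) : int :=
  xget 0 [set n : int | exists2 u : fps k,
    fps_coef u 0 != 0 & y = tau i u * tau i fpsX ^ n].

Definition zero_comp : set K := [set h | exists i, pi i h = 0].

Definition val (h : K) : {ffun 'I_r -> int} :=
  [ffun i => branch_val (pi i h)].

Definition value_set (A : set K) : set {ffun 'I_r -> int} :=
  val @` (A `\` zero_comp).

End Branches.
End TotalFractions.
End Curve.

(** * Subsets of Z^r *)

Section Values.
Variable r : nat.
Implicit Types (E S : set {ffun 'I_r -> int}) (a b g : {ffun 'I_r -> int}).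

Definition le_vec a b : Prop := forall i, a i <= b i.

Definition conductor_bound S : set {ffun 'I_r -> int} :=
  [set g | S g /\ forall b, le_vec g b -> S b].

Definition conductor S : {ffun 'I_r -> int} :=
  xget 0 [set g | conductor_bound S g /\
                  forall b, conductor_bound S b -> le_vec g b].

Definition frobenius S : {ffun 'I_r -> int} := conductor S - [ffun=> 1].

Definition fiber (J : {set 'I_r}) E a : set {ffun 'I_r -> int} :=
  [set b | [/\ E b, forall i, i \in J -> b i = a i &
               forall i, i \notin J -> a i < b i]].

Definition fibers E a : set {ffun 'I_r -> int} :=
  \bigcup_(i in [set: 'I_r]) fiber [set i]%SET E a.

Definition maximal E a : Prop := E a /\ fibers E a = set0.

Definition absolute_maximal E a : Prop :=
  maximal E a /\ forall J : {set 'I_r},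
    J <> finset.set0 -> J <> [set: 'I_r]%SET -> fiber J E a = set0.

Definition relative_maximal E a : Prop :=
  maximal E a /\ forall J : {set 'I_r},
    (2 <= #|J|)%N -> fiber J E a !=set0.

End Values.

(* Main.v *)
Require Import Defs.
From HB Require Import structures.
From mathcomp Require Import all_boot all_order all_algebra.
From mathcomp Require Import boolp classical_sets.
From mathcomp Require Import ring zify.
Set Implicit Arguments.
Unset Strict Implicit.
Unset Printing Implicit Defensive.
Import Order.TTheory GRing.Theory Num.Theory.
Local Open Scope ring_scope.
Local Open Scope classical_set_scope.

(** The proof replaces values by jumps. For a subspace [M] of the total ring of
    fractions, [i] is a jump of [M] at [a] if some element of [M] has order
    [a i] along the branch [i] and order at least [a j] along every branch [j].
    Since the residue field is infinite, linear combinations realize finitely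
    many jumps at once, so that all fibers of a value set, and the value set
    itself, are determined by the jumps ([fiber_jumpP]).

    With [c] the conductor, the key fact is [jump_dual]: [i] is a jump of a
    fractional ideal [I] at [a] if and only if it is not a jump of the dual of
    [I] at the mirror vector [c - a - unitv i]. Both claims follow from it by
    bookkeeping on vectors. That [b] is a maximal of [E*] says that there is no
    jump of [I*] just above [b], hence that every [i] is a jump of [I] at
    [f - b], hence that [f - b] belongs to [E]. Likewise the fibers of [E*] over
    [b] for subsets with at least two elements correspond to the fibers of [E]
    over [f - b] for proper subsets ([absolute_relative_dual]).

    Two mirror vectors cannot both be jumps, because the product of the
    elements that realize them would be an element of the ring of order
    [c i - 1] at [i] and at least [c j] elsewhere, against the minimality of the
    conductor ([pairing_jump]). That one of them is a jump is proved in three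
    stages.

    - For the ring itself ([symmetry_ringO]), the number of jumps on a path of
      unit steps is a colength, and the Gorenstein condition leaves exactly one
      jump for each pair of mirror steps.

    - Consequently the elements that the maximal ideal multiplies into the ring
      form a line modulo the ring, spanned by any element of order [c j - 1] at
      one branch [j] and zero elsewhere ([socle_line]).

    - If [i] is not a jump of [I] at [a], then [t_i ^ (c i - a i - 1)] multiplies
      the elements of [I] of order at least [a] into the ring. It can be
      corrected, by terms of higher order and one dimension at a time, to
      multiply all of [I] into the ring; the socle line is what makes a single
      scalar sufficient at every step ([dual_jump]). The corrected element
      realizes the jump of the dual. *)

(** * Formal power series *)

Section PowerSeries.
Variable R : comNzRingType.
Implicit Types f g h : fps R.

Lemma fps_coefM f g n :
  fps_coef (f * g) n = \sum_(i < n.+1) fps_coef f i * fps_coef g (n - i)%N.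
Proof. by []. Qed.

Lemma fps_coef1 n : fps_coef (1 : fps R) n = (n == 0)%:R.
Proof. by case: n. Qed.

Lemma fps_coefM0 f g : fps_coef (f * g) 0 = fps_coef f 0 * fps_coef g 0.
Proof. by rewrite fps_coefM big_ord_recl big_ord0 addr0. Qed.

Lemma fps_coefCM0 c f : fps_coef (fpsC c * f) 0 = c * fps_coef f 0.
Proof. by rewrite fps_coefM0. Qed.

Definition fps_shift f : fps R := Fps (fun n => fps_coef f n.+1).

Lemma fps_shiftK f : fps_coef f 0 = 0 -> f = fps_shift f * fpsX.
Proof.
move=> f0; rewrite mulrC; apply: fpsP => -[|n].
  by rewrite fps_coefM0 /= mul0r.
rewrite fps_coefM 2!big_ord_recl /= mul0r add0r mul1r subSS subn0.
by rewrite big1 ?addr0 // => i _; rewrite mul0r.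
Qed.

Lemma fpsX_neq0 : (fpsX : fps R) != 0.
Proof.
by apply/eqP => /(congr1 (fun f => fps_coef f 1)) /= /eqP; rewrite oner_eq0.
Qed.

Lemma fps_coef_exp_lt h m n :
  fps_coef h 0 = 0 -> (n < m)%N -> fps_coef (h ^+ m) n = 0.
Proof.
move=> h0; elim: m n => // m IHm n ltnm.
rewrite exprS fps_coefM big_ord_recl h0 mul0r add0r big1 // => i _.
by rewrite IHm ?mulr0 //; have := ltn_ord i; rewrite lift0; lia.
Qed.

(** The inverse of [1 - h], for [h] without constant term, is the geometric
    series of [h]; its coefficients are finite sums because the terms of degree
    less than [m] vanish in [h ^+ m]. *)
Lemma fps_geometric h :
  fps_coef h 0 = 0 -> exists w, (1 - h) * w = 1.
Proof.
move=> h0.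
pose w : fps R := Fps (fun n => \sum_(m < n.+1) fps_coef (h ^+ m) n).
exists w; suff hw : h * w = w - 1 by rewrite mulrBl mul1r hw opprB addrC subrK.
apply: fpsP => n.
have wE N l : (l <= N)%N -> fps_coef w l = \sum_(m < N.+1) fps_coef (h ^+ m) l.
  move=> le_lN; rewrite [LHS]/=.
  rewrite (big_ord_widen N.+1 (fun m => fps_coef (h ^+ m) l)) //.
  rewrite big_mkcond /=; apply: eq_bigr => m _.
  by case: ifPn => // ltlm; rewrite fps_coef_exp_lt // ltnNge.
rewrite fps_coefM.
under eq_bigr => i _ do rewrite (wE n) ?leq_subr // big_distrr /=.
rewrite exchange_big /=.
under eq_bigr => m _ do rewrite -fps_coefM -exprS.
rewrite -[RHS]/(fps_coef w n - fps_coef 1 n) (wE n.+1 n) //.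
by rewrite (big_ord_recl n.+1) expr0 addrC addKr.
Qed.

End PowerSeries.

Section PowerSeriesField.
Variable k : fieldType.
Implicit Types f u : fps k.

Lemma fps_inv u : fps_coef u 0 != 0 -> exists w, u * w = 1.
Proof.
move=> u0; set a := fps_coef u 0 in u0.
have [|w hw] := @fps_geometric _ (1 - fpsC a^-1 * u).
  by rewrite -[LHS]/(1 - fps_coef (fpsC a^-1 * u) 0) fps_coefM0 /= mulVf ?subrr.
exists (fpsC a^-1 * w); rewrite mulrCA mulrA -[RHS]hw; congr (_ * w).
by rewrite opprB addrC subrK.
Qed.

Lemma fps_factor f : f != 0 ->
  exists u n, fps_coef u 0 != 0 /\ f = u * fpsX ^+ n.
Proof.
move=> f_neq0.
have [n fn] : exists n, fps_coef f n != 0.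
  apply: contrapT => nf; case/eqP: f_neq0; apply: fpsP => n.
  have -> : fps_coef (0 : fps k) n = 0 by case: n.
  by apply/eqP/negPn/negP => fn; apply: nf; exists n.
elim: n f fn {f_neq0} => [|n IHn] f fn.
  by exists f, 0; rewrite expr0 mulr1.
have [f0|f0] := eqVneq (fps_coef f 0) 0; last first.
  by exists f, 0; rewrite expr0 mulr1.
have [u [m [u0 Ef]]] := IHn (fps_shift f) fn.
by exists u, m.+1; split=> //; rewrite (fps_shiftK f0) Ef exprSr mulrA.
Qed.

End PowerSeriesField.

(** A root of [1 + \prod_(a <- s) ('X - a%:P)] is not in [s]. *)
Lemma closed_field_infinite (k : closedFieldType) (s : seq k) :
  exists a, a \notin s.
Proof.
pose p := \prod_(a <- s) ('X - a%:P) + 1 : {poly k}.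
have [s0|s0] := eqVneq (size s) 0%N.
  by exists 0; rewrite (size0nil s0).
have szp : size p != 1%N.
  by rewrite size_polyDl size_prod_XsubC ?size_poly1 // ltnS lt0n.
have /closed_rootP[a pa0] := szp; exists a; apply/negP => sa.
move: pa0; rewrite /root hornerD hornerC.
have /rootP -> : root (\prod_(a <- s) ('X - a%:P)) a by rewrite root_prod_XsubC.
by rewrite add0r oner_eq0.
Qed.

(** * Dimensions of quotients *)

Section QuotientDimension.
Variables (k : closedFieldType) (K : comUnitAlgType k).
Implicit Types (A B : set K) (x y : K) (c d : k).

Definition subspace A : Prop :=
  [/\ A 0, forall x y, A x -> A y -> A (x + y) &
      forall c x, A x -> A (c *: x)].

Lemma subspaceI A B : subspace A -> subspace B -> subspace (A `&` B).
Proof.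
move=> [A0 AD AZ] [B0 BD BZ]; split=> //.
  by move=> x y [Ax Bx] [Ay By]; split; [apply: AD|apply: BD].
by move=> c x [Ax Bx]; split; [apply: AZ|apply: BZ].
Qed.

Lemma subspaceB A x y : subspace A -> A x -> A y -> A (x - y).
Proof. by move=> [_ AD AZ] Ax Ay; rewrite -scaleN1r; apply/AD/AZ. Qed.

Lemma subspace_sum A n (F : 'I_n -> K) :
  subspace A -> (forall i, A (F i)) -> A (\sum_i F i).
Proof. by move=> [A0 AD _] AF; elim/big_ind: _. Qed.

Lemma quot_dim_refl A B : A `<=` B -> quot_dim A B 0.
Proof.
move=> AB; exists (fun=> 0); split=> [[] //|x Ax].
exists [ffun=> 0]; split=> [|c _]; first by rewrite big_ord0 subr0; apply: AB.
by apply/ffunP => -[].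
Qed.

Lemma quot_dim_step A B B' x0 m : subspace B -> subspace B' -> B' `<=` B ->
    A x0 -> B x0 -> ~ B' x0 -> (forall x, B x -> exists c, B' (x - c *: x0)) ->
  quot_dim A B m -> quot_dim A B' m.+1.
Proof.
move=> sB sB' B'B Ax0 Bx0 nB'x0 lineB [e [Ae eP]].
exists (fun i => if unlift ord0 i is Some j then e j else x0).
split=> [i|x Ax]; first by case: unliftP.
have [c [Bc c_uniq]] := eP x Ax; have [d B'd] := lineB _ Bc.
have sumE (b : {ffun 'I_m.+1 -> k}) :
    \sum_i b i *: (if unlift ord0 i is Some j then e j else x0) =
    b ord0 *: x0 + \sum_j b (lift ord0 j) *: e j.
  by rewrite big_ord_recl unlift_none; under eq_bigr => j _ do rewrite liftK.
exists [ffun i => if unlift ord0 i is Some j then c j else d]; split.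
  rewrite sumE ffunE unlift_none; under eq_bigr => j _ do rewrite ffunE liftK.
  by rewrite opprD addrA addrAC.
move=> b; rewrite sumE => B'b.
have cE : c = [ffun j => b (lift ord0 j)].
  apply: c_uniq; under eq_bigr => j _ do rewrite ffunE.
  have [_ BD BZ] := sB; have := BD _ _ (B'B _ B'b) (BZ (b ord0) _ Bx0).
  by rewrite opprD addrA addrAC subrK.
have dE : d = b ord0.
  apply: contrapT => nd; apply: nB'x0.
  have [_ _ B'Z] := sB'; have := B'Z (b ord0 - d)^-1 _ (subspaceB sB' B'd B'b).
  rewrite cE; under eq_bigr => j _ do rewrite ffunE.
  set S := \sum_(j < m) _.
  have -> : x - S - d *: x0 - (x - (b ord0 *: x0 + S)) = (b ord0 - d) *: x0.
    by rewrite scalerBl; ring.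
  rewrite scalerA mulVf ?scale1r // subr_eq0.
  by apply/eqP => bd; apply: nd.
apply/ffunP => i; rewrite ffunE; case: unliftP => [j|] -> //.
by rewrite cE ffunE.
Qed.

(** The coordinates of each family in the other one form two matrices with
    product the identity. *)
Lemma quot_dim_le A B m n :
  subspace B -> quot_dim A B m -> quot_dim A B n -> (m <= n)%N.
Proof.
move=> sB [e [Ae eP]] [e' [Ae' e'P]].
have /choice[M MP] i : exists c : {ffun 'I_n -> k}, B (e i - \sum_j c j *: e' j).
  by have [c [Bc _]] := e'P _ (Ae i); exists c.
have /choice[N NP] j : exists c : {ffun 'I_m -> k}, B (e' j - \sum_i c i *: e i).
  by have [c [Bc _]] := eP _ (Ae' j); exists c.
have MN : (\matrix_(i, j) M i j) *m (\matrix_(j, l) N j l) = 1%:M.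
  apply/matrixP => i l; rewrite !mxE; under eq_bigr => j _ do rewrite !mxE.
  have [c [_ c_uniq]] := eP _ (Ae i).
  transitivity (c l); last first.
    rewrite (c_uniq [ffun l => (i == l)%:R]) ?ffunE //.
    rewrite (bigD1 i) //= ffunE eqxx scale1r big1 ?addr0 ?subrr.
      by have [] := sB.
    by move=> j ji; rewrite ffunE eq_sym (negPf ji) scale0r.
  rewrite (c_uniq [ffun l => \sum_j M i j * N j l]) ?ffunE //.
  have -> : e i - \sum_l [ffun l => \sum_j M i j * N j l] l *: e l =
      e i - \sum_j M i j *: e' j +
      \sum_j M i j *: (e' j - \sum_l N j l *: e l).
    rewrite (eq_bigr (fun l => \sum_j (M i j * N j l) *: e l)); last first.
      by move=> q _; rewrite ffunE scaler_suml.
    under [X in _ = _ + X]eq_bigr => j _ do rewrite scalerBr scaler_sumr.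
    rewrite sumrB exchange_big /= addrA subrK; congr (_ - _).
    by apply: eq_bigr => j _; apply: eq_bigr => q _; rewrite scalerA.
  have [_ BD BZ] := sB; apply: BD => //; apply: subspace_sum => // j.
  exact: BZ.
exact: mulmx1_min MN.
Qed.

Lemma quot_dim_uniq A B m n :
  subspace B -> quot_dim A B m -> quot_dim A B n -> m = n.
Proof.
move=> sB dm dn; apply/eqP; rewrite eqn_leq.
by rewrite (quot_dim_le sB dm dn) (quot_dim_le sB dn dm).
Qed.

End QuotientDimension.

(** * Vectors of integers *)

Section Vectors.
Variable r : nat.
Implicit Types (a b : {ffun 'I_r -> int}) (i j : 'I_r).

Definition unitv i : {ffun 'I_r -> int} := [ffun j => (j == i)%:R].

Lemma le_vecP a b : le_vec a b -> a != b -> exists i, a i < b i.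
Proof.
move=> le_ab; apply: contraNP => nlt; apply/eqP/ffunP => i; apply/eqP.
rewrite eq_le le_ab leNgt; apply/negP => lt; apply: nlt; by exists i.
Qed.

Lemma vec_ind (P : {ffun 'I_r -> int} -> Prop) a :
    P a -> (forall b i, le_vec a b -> P b -> P (b + unitv i)) ->
  forall b, le_vec a b -> P b.
Proof.
move=> Pa Pstep b; move: {2}(\sum_i `|b i - a i|)%N (leqnn (\sum_i `|b i - a i|)) => n.
elim: n b => [|n IHn] b le_n le_ab.
  suff -> : b = a by []; apply/ffunP => i; move: le_n.
  by rewrite leqn0 sum_nat_eq0 => /forallP/(_ i)/=; lia.
have [<- //|ab] := eqVneq a b; have [i lt_i] := le_vecP le_ab ab.
have le_ab' : le_vec a (b - unitv i).
  by move=> j; rewrite !ffunE; have := le_ab j; case: eqP => [->|_] /=; lia.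
rewrite -[b](subrK (unitv i)); apply: (Pstep) => //; apply: IHn => //.
rewrite -ltnS; apply: leq_trans le_n.
rewrite (bigD1 i) // [X in (_ < X)%N](bigD1 i) //= !ffunE eqxx.
rewrite (eq_bigr (fun j => `|b j - a j|)%N) => [|j ji]; first by move=> /=; lia.
by rewrite !ffunE (negPf ji) subr0.
Qed.

Lemma le_vec_refl a : le_vec a a. Proof. by move=> i. Qed.

Lemma le_vec_trans a b c : le_vec a b -> le_vec b c -> le_vec a c.
Proof. by move=> ab bc i; apply: le_trans (ab i) (bc i). Qed.

Lemma vec_lower a b : exists l, le_vec l a /\ le_vec l b.
Proof.
by exists [ffun i => Num.min (a i) (b i)]; split=> i; rewrite ffunE; lia.
Qed.

Lemma vec_upper a b : exists u, le_vec a u /\ le_vec b u.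
Proof.
by exists [ffun i => Num.max (a i) (b i)]; split=> i; rewrite ffunE; lia.
Qed.

Lemma vec_ind_down (P : {ffun 'I_r -> int} -> Prop) a :
    P a -> (forall b i, le_vec b a -> P b -> P (b - unitv i)) ->
  forall b, le_vec b a -> P b.
Proof.
move=> Pa Pstep b le_ba; rewrite -[b]opprK.
apply: (@vec_ind (fun b => P (- b)) (- a)); rewrite ?opprK //.
  move=> d i le_d Pb; rewrite opprD; apply: Pstep => // j.
  by have := le_d j; rewrite !ffunE lerNl.
by move=> i; rewrite !ffunE lerN2; apply: le_ba.
Qed.

(** Adding [off J] to [a] turns the strict inequalities of a fiber over [a], which
    concern the indices outside [J], into weak ones. *)
Definition off (J : {set 'I_r}) : {ffun 'I_r -> int} :=
  [ffun i => (i \notin J)%:R].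

End Vectors.

(** * From jumps to maximals *)

Section JumpDuality.
Variables (r : nat) (c : {ffun 'I_r -> int}) (E F : set {ffun 'I_r -> int}).
Variables jE jF : 'I_r -> {ffun 'I_r -> int} -> Prop.
Implicit Types (a b : {ffun 'I_r -> int}) (i j : 'I_r) (J : {set 'I_r}).

(** The jumps of the value set of a module [M] are the pairs [(i, a)] such that
    some element of [M] has order [a i] at [i] and order at least [a j] at every
    [j]. Unlike membership in the value set, they behave well under duality. *)
Definition fibers_by_jumps A (jA : 'I_r -> {ffun 'I_r -> int} -> Prop) : Prop :=
  forall J a, fiber J A a !=set0 <-> forall i, i \in J -> jA i (a + off J).

Hypothesis fiberE : fibers_by_jumps E jE.
Hypothesis fiberF : fibers_by_jumps F jF.
Hypothesis dual : forall i a, jE i a <-> ~ jF i (c - a - unitv i).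

Lemma value_jumps A jA a : fibers_by_jumps A jA -> A a <-> forall i, jA i a.
Proof.
move=> fA; have := fA [set: 'I_r]%SET a.
have -> : a + off [set: 'I_r]%SET = a.
  by apply/ffunP => i; rewrite !ffunE finset.in_setT addr0.
move=> [fj jf]; split=> [Aa i|ja].
  by apply: fj; rewrite ?finset.in_setT //; exists a; split=> // j; rewrite finset.in_setT.
have [//|b [Ab ba _]] := jf.
suff <- : b = a by [].
by apply/ffunP => i; apply: ba; rewrite finset.in_setT.
Qed.

Lemma maximal_jumps A jA a : fibers_by_jumps A jA -> A a ->
  maximal A a <-> forall i, ~ jA i (a + off [set i]%SET).
Proof.
move=> fA Aa; split=> [[_ fib0] i ji|nj].
  have [|b fb] := (fA [set i]%SET a).2.
    by move=> j; rewrite finset.in_set1 => /eqP ->.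
  by have : fibers A a b; [exists i|rewrite fib0].
split=> //; apply/seteqP; split=> // b [i _ fb]; apply: (nj i).
by apply: ((fA [set i]%SET a).1); [exists b|rewrite finset.set11].
Qed.

Lemma jump_value i a : jE i a -> exists b, [/\ E b, le_vec a b & b i = a i].
Proof.
move=> ji; have [|b [Eb bi bj]] := (fiberE [set i]%SET (a - off [set i]%SET)).2.
  by move=> j; rewrite finset.in_set1 subrK => /eqP ->.
have b_i : b i = a i by rewrite bi ?finset.set11 // !ffunE finset.set11 subr0.
exists b; split=> // j; have [->|ji'] := eqVneq j i; first by rewrite b_i.
by have := bj j; rewrite !ffunE finset.in_set1 ji' /= => /(_ isT); lia.
Qed.

Lemma maximal_dual b :
  F b -> maximal F b <-> E (c - [ffun=> 1] - b).
Proof.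
move=> Fb; rewrite (maximal_jumps fiberF Fb) (value_jumps _ fiberE).
have Ei i : c - (c - [ffun=> 1] - b) - unitv i = b + off [set i]%SET.
  apply/ffunP => j; rewrite !ffunE finset.in_set1.
  by case: (j == i) => /=; ring.
by split=> nj i; [apply/dual; rewrite Ei|move/dual: (nj i); rewrite Ei].
Qed.

Lemma maximal_of_sum a b :
  E a -> F b -> a + b = c - [ffun=> 1] -> maximal E a /\ maximal F b.
Proof.
move=> Ea Fb Eab; split; last by apply/maximal_dual => //; rewrite -Eab addrK.
apply/(maximal_jumps fiberE Ea) => i /dual; apply.
have -> : c - (a + off [set i]%SET) - unitv i = b.
  apply/ffunP => j; have := congr1 (fun v : {ffun _} => v j) Eab.
  by rewrite !ffunE finset.in_set1; case: (j == i) => /=; lia.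
by move: i; apply/(value_jumps _ fiberF).
Qed.

(** For [i] in [J], the jump [(i, b + off J)] of [F] is dual to
    [(i, a + off J')], where [J'] consists of [i] and the complement of [J]. So a
    missing element in a fiber of [F] gives an element of [E] in a fiber over a
    proper subset, and conversely. *)
Lemma absolute_relative_dual a b : E a -> F b -> a + b = c - [ffun=> 1] ->
  absolute_maximal E a <-> relative_maximal F b.
Proof.
move=> Ea Fb Eab; have [maxa maxb] := maximal_of_sum Ea Fb Eab.
have Ej j : a j + b j = c j - 1.
  by have := congr1 (fun v : {ffun _} => v j) Eab; rewrite !ffunE.
split=> [[_ abs]|[_ rel]]; split=> //.
  move=> J J2; apply/fiberF => i iJ; apply: contrapT => nj.
  have : jE i (c - (b + off J) - unitv i).
    apply/dual; have -> // : c - (c - (b + off J) - unitv i) - unitv i = b + off J.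
    by apply/ffunP => j; rewrite !ffunE; ring.
  move=> /jump_value[g [Eg le_g gi]].
  pose L := [set j | g j == a j]%SET.
  have a_le j : a j <= g j.
    have := le_g j; have := Ej j; rewrite !ffunE.
    by have [->|_] := eqVneq j i; rewrite ?iJ; case: (j \in J) => /=; lia.
  have iL : i \in L.
    by rewrite inE gi; have := Ej i; rewrite !ffunE iJ eqxx /=; lia.
  have /card_gt1P[j1 [j2 [j1J j2J j12]]] := J2.
  have [j jJ ji] : exists2 j, j \in J & j != i.
    have [e1|] := eqVneq j1 i; last by exists j1.
    by exists j2 => //; rewrite -e1 eq_sym.
  have jL : j \notin L.
    have := le_g j; have := Ej j; rewrite inE !ffunE jJ (negPf ji) /=; lia.
  have := abs L _ _; rewrite -subset0 => /(_ _ _ g); apply.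
  - by move=> L0; rewrite L0 finset.in_set0 in iL.
  - by move=> LT; rewrite LT finset.in_setT in jL.
  split=> // l; rewrite inE; first by move/eqP.
  by have := a_le l; lia.
move=> J J0 JT; apply/seteqP; split=> // g fg; exfalso.
have [J0'|[i iJ]] := finset.set_0Vmem J; first exact: J0.
have [l lJ] : exists l, l \notin J.
  apply: contrapT => nl; apply: JT; apply/finset.setP => l; rewrite finset.in_setT.
  by apply: contrapT => /negP lJ; apply: nl; exists l.
pose J' := (i |: ~: J)%SET.
have J'2 : (1 < #|J'|)%N.
  apply/card_gt1P; exists i, l; rewrite !inE eqxx lJ orbT; split=> //.
  by apply: contraNneq lJ => <-.
have ji : jE i (a + off J) by apply: (fiberE J a).1 => //; exists g.
have ji' : jF i (b + off J').
  by apply: (fiberF J' b).1; [exact: rel|rewrite !inE eqxx].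
move/dual: ji; apply; have -> // : c - (a + off J) - unitv i = b + off J'.
apply/ffunP => j; have := Ej j; rewrite !ffunE !inE.
by have [->|_] := eqVneq j i; rewrite ?iJ; case: (j \in J) => /=; lia.
Qed.

End JumpDuality.

(** * Leading terms along the branches *)

Section Branches.
Variables (k : closedFieldType) (O : comUnitAlgType k).
Variables (r : nat) (wp : 'I_r -> set O).
Variables (K : comUnitAlgType k) (iota : {lrmorphism O -> K}).
Variables (Ki : 'I_r -> fieldType) (pi : forall i, {rmorphism K -> Ki i}).
Variable tau : forall i, {rmorphism fps k -> Ki i}.
Hypothesis hbr : branches iota wp pi tau.
Local Notation vec := {ffun 'I_r -> int}.
Implicit Types (i j : 'I_r) (n m : int) (x y : K) (c d : k) (a b : vec).

(** [lterm i n x c]: the [i]-th component of [x] is [c * t_i ^ n] plus terms of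
    higher order; [c] may be zero. *)
Definition lterm i n x c : Prop :=
  exists2 f, fps_coef f 0 = c & pi i x = tau i f * tau i fpsX ^ n.

Definition ge i n x : Prop := exists c, lterm i n x c.

Definition exact i n x : Prop := exists2 c, c != 0 & lterm i n x c.

(** The fractional ideal [t ^ a] of the normalization, which is [T 0]. *)
Definition T a : set K := [set x | forall i, ge i (a i) x].

Lemma tauX_neq0 i : tau i fpsX != 0.
Proof.
apply/eqP => X0; have := fpsX_neq0 k; case/eqP.
by apply: (branch_inj hbr (i := i)); rewrite X0 rmorph0.
Qed.

Lemma tauX_unit i n : tau i fpsX ^ n != 0.
Proof. by rewrite expfz_neq0 // tauX_neq0. Qed.

Lemma pi_scale i c x : pi i (c *: x) = tau i (fpsC c) * pi i x.
Proof. by rewrite (branch_const hbr) -rmorphM mulr_algl. Qed.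

Lemma pi_inj x y : (forall i, pi i x = pi i y) -> x = y.
Proof.
by move=> Exy; have [z [_ zu]] := branch_prod hbr (fun i => pi i y);
  rewrite -(zu x) // (zu y).
Qed.

Lemma ltermD i n x y c d :
  lterm i n x c -> lterm i n y d -> lterm i n (x + y) (c + d).
Proof.
move=> [f <- Ef] [g <- Eg]; exists (f + g) => //.
by rewrite !rmorphD mulrDl Ef Eg.
Qed.

Lemma ltermZ i n x c d : lterm i n x c -> lterm i n (d *: x) (d * c).
Proof.
move=> [f <- Ef]; exists (fpsC d * f); first by rewrite fps_coefCM0.
by rewrite pi_scale Ef rmorphM mulrA.
Qed.

Lemma ltermM i n m x y c d :
  lterm i n x c -> lterm i m y d -> lterm i (n + m) (x * y) (c * d).
Proof.
move=> [f <- Ef] [g <- Eg]; exists (f * g); first by rewrite fps_coefM0.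
by rewrite !rmorphM Ef Eg expfzDr ?tauX_neq0 // mulrACA.
Qed.

Lemma lterm_uniq i n x c d : lterm i n x c -> lterm i n x d -> c = d.
Proof.
move=> [f <- Ef] [g <- Eg]; congr (fps_coef _ 0).
apply: (branch_inj hbr (i := i)); apply: (mulIf (tauX_unit i n)).
by rewrite -Ef.
Qed.

Lemma lterm_zero i n x : pi i x = 0 -> lterm i n x 0.
Proof. by move=> x0; exists 0; rewrite // rmorph0 mul0r. Qed.

Lemma lterm0P i n x : lterm i n x 0 <-> ge i (n + 1) x.
Proof.
split=> [[f f0 Ef]|[c [f _ Ef]]].
  exists (fps_coef (fps_shift f) 0), (fps_shift f) => //.
  rewrite Ef {1}(fps_shiftK f0) rmorphM addrC expfzDr ?tauX_neq0 //.
  by rewrite expr1z mulrA.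
exists (f * fpsX); first by rewrite fps_coefM0 /= mulr0.
by rewrite Ef rmorphM addrC expfzDr ?tauX_neq0 // expr1z mulrA.
Qed.

Lemma ge_le i n m x : m <= n -> ge i n x -> ge i m x.
Proof.
move=> le_mn; have -> : n = m + `|n - m|%N by lia.
elim: `|n - m|%N => [|p IHp] gx; first by rewrite -[m]addr0.
apply: IHp; exists 0; apply/lterm0P.
by have <- : m + p.+1%:Z = m + p%:Z + 1 by lia.
Qed.

Lemma exact_not_ge i n x : exact i n x -> ~ ge i (n + 1) x.
Proof.
move=> [c c0 xc] /lterm0P x0; move: c0.
by rewrite (lterm_uniq xc x0) eqxx.
Qed.

Lemma exact_ge i n x : exact i n x -> ge i n x.
Proof. by case=> c _; exists c. Qed.

Lemma ge_exact i n x : ge i n x -> exact i n x \/ ge i (n + 1) x.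
Proof.
move=> [c xc]; have [c0|c0] := eqVneq c 0; last by left; exists c.
by right; apply/lterm0P; rewrite -c0.
Qed.

Lemma geD i n x y : ge i n x -> ge i n y -> ge i n (x + y).
Proof. by move=> [c xc] [d yd]; exists (c + d); apply: ltermD. Qed.

Lemma geZ i n x c : ge i n x -> ge i n (c *: x).
Proof. by move=> [d xd]; exists (c * d); apply: ltermZ. Qed.

Lemma geM i n m x y : ge i n x -> ge i m y -> ge i (n + m) (x * y).
Proof. by move=> [c xc] [d yd]; exists (c * d); apply: ltermM. Qed.

Lemma exactM i n m x y : exact i n x -> exact i m y -> exact i (n + m) (x * y).
Proof.
move=> [c c0 xc] [d d0 yd]; exists (c * d); first by rewrite mulf_neq0.
exact: ltermM.
Qed.

Lemma exactDr i n x y : exact i n x -> ge i (n + 1) y -> exact i n (x + y).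
Proof.
move=> [c c0 xc] gy; exists c => //; rewrite -[c]addr0; apply: ltermD => //.
exact/lterm0P.
Qed.

(** Elements of [O] are integral over [O], hence power series in [t_i]; nonzero
    power series are a unit times a power of [t_i], and every element of [Ki i]
    is a fraction of two of them. *)
Lemma exact_neq0 i x : pi i x != 0 -> exists n, exact i n x.
Proof.
move=> x0; have [a [b [b0 Ex]]] := branch_frac hbr (pi i x).
have tau_O w : exists f, tau i f = pi i (iota w).
  by apply/(branch_normal hbr)/(@integral_id _ _ (pi i \o iota)).
have [f Ef] := tau_O a; have [g Eg] := tau_O b.
have f0 : f != 0.
  by apply: contra_neq x0 => f0; rewrite Ex -Ef f0 rmorph0 mul0r.
have g0 : g != 0 by apply: contra_neq b0 => g0; rewrite -Eg g0 rmorph0.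
have [u [n [u0 Eu]]] := fps_factor f0; have [v [m [v0 Ev]]] := fps_factor g0.
have [w vw] := fps_inv v0.
have w0 : fps_coef w 0 != 0.
  have := congr1 (fun f => fps_coef f 0) vw; rewrite /= big_ord1 => vw0.
  by apply: contra_eq_neq vw0 => ->; rewrite mulr0 eq_sym oner_neq0.
exists (n%:Z - m%:Z), (fps_coef u 0 * fps_coef w 0); first by rewrite mulf_neq0.
exists (u * w); first by rewrite fps_coefM0.
rewrite Ex -Ef -Eg Eu Ev !rmorphM !rmorphXn expfzDr ?tauX_neq0 //.
rewrite -exprnN -exprnP invfM.
have -> : (tau i v)^-1 = tau i w.
  apply: (mulfI (x := tau i v)).
    by apply/eqP => v00; move/eqP: (congr1 (tau i) vw);
      rewrite rmorphM v00 mul0r rmorph1 eq_sym oner_eq0.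
  rewrite -rmorphM vw rmorph1 divff //.
  by apply/eqP => v00; move/eqP: (congr1 (tau i) vw);
    rewrite rmorphM v00 mul0r rmorph1 eq_sym oner_eq0.
by rewrite mulrACA.
Qed.

Lemma exact_pi_neq0 i n x : exact i n x -> pi i x != 0.
Proof.
move=> [c c0 xc]; apply: contra_neq c0 => x0.
by apply: lterm_uniq xc _; apply: lterm_zero.
Qed.

Lemma exact_uniq i n m x : exact i n x -> exact i m x -> n = m.
Proof.
wlog lt_nm : n m / n < m => [wlog_lt|] xn xm.
  by case: (ltgtP n m) => // lt; [|symmetry]; apply: wlog_lt.
case: (exact_not_ge xn); apply: ge_le (exact_ge xm); lia.
Qed.

Lemma ge_bounded i x : exists n, ge i n x.
Proof.
have [x0|/exact_neq0[n xn]] := eqVneq (pi i x) 0.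
  by exists 0, 0; apply: lterm_zero.
by exists n; apply: exact_ge.
Qed.

Lemma T_bounded x : exists a, T a x.
Proof.
have [a aP] := choice (fun i => ge_bounded i x).
by exists [ffun i => a i] => i; rewrite ffunE.
Qed.

(** The element of [K] with [i]-th component [t_i ^ n] and no other nonzero
    component. *)
Definition tpow i n : K :=
  xget 0 [set x | forall j, pi j x = if j == i then tau j fpsX ^ n else 0].

Lemma tpowE i n j : pi j (tpow i n) = if j == i then tau j fpsX ^ n else 0.
Proof.
rewrite /tpow; case: xgetP => [_ -> /(_ j)//|none].
have [x [xP _]] := branch_prod hbr (fun j => if j == i then tau j fpsX ^ n else 0).
by case: (none x).
Qed.

Lemma lterm_tpow i n : lterm i n (tpow i n) 1.
Proof.
exists 1; first by rewrite fps_coef1.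
by rewrite tpowE eqxx rmorph1 mul1r.
Qed.

Lemma exact_tpow i n : exact i n (tpow i n).
Proof. by exists 1; [exact: oner_neq0|exact: lterm_tpow]. Qed.

Lemma ge_other i m x : pi i x = 0 -> ge i m x.
Proof. by move=> x0; exists 0; apply: lterm_zero. Qed.

Lemma tpow_other i j n : j != i -> pi j (tpow i n) = 0.
Proof. by rewrite tpowE => /negPf ->. Qed.

Lemma T_tpow i n a : a i <= n -> T a (tpow i n).
Proof.
move=> le_an j; have [->|ji] := eqVneq j i; last exact/ge_other/tpow_other.
exact: ge_le le_an (exact_ge (exact_tpow i n)).
Qed.

(** If [p i] is an integral equation of the [i]-th component of [x], then the
    product of all [p i] annihilates every component of [x]. *)
Lemma integral_closureE : integral_closure iota = T 0.
Proof.
apply/seteqP; split=> x.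
  move=> intx i; rewrite ffunE.
  have /(branch_normal hbr)[f Ef] : integralOver (fun w => pi i (iota w)) (pi i x).
    exact: (integral_rmorph (pi i) intx).
  by exists (fps_coef f 0), f; rewrite // expr0z mulr1.
move=> Tx.
have /choice[p pP] i : exists p : {poly O}, p \is monic /\
    root (map_poly (pi i \o iota) p) (pi i x).
  have /(branch_normal hbr)[p p1 px] : exists f, tau i f = pi i x.
    have [c [f _ Ef]] := Tx i; exists f.
    by rewrite Ef ffunE expr0z mulr1.
  by exists p.
exists (\prod_i p i); first by apply: monic_prod => i _; case: (pP i).
apply/rootP/pi_inj => i; rewrite rmorph0 -horner_map -map_poly_comp.
apply/rootP; rewrite rmorph_prod (bigD1 i) //= rootM.
by case: (pP i) => _ ->.
Qed.

Lemma value_setP (A : set K) a :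
  value_set pi tau A a <-> exists2 x, A x & forall i, exact i (a i) x.
Proof.
have valE x : (forall i, pi i x != 0) ->
    forall i, exact i (Defs.val pi tau x i) x.
  move=> x0 i; have [n xn] := exact_neq0 (x0 i).
  rewrite ffunE /branch_val; case: xgetP => [m _ [u u0 Ex]|/(_ n)[]].
    by exists (fps_coef u 0) => //; exists u.
  by have [c c0 [u uc Ex]] := xn; exists u; rewrite ?uc.
split=> [[x [Ax x0] <-]|[x Ax xa]].
  by exists x => //; apply: valE => i; apply/eqP => xi; apply: x0; exists i.
have x0 i : pi i x != 0 by apply: exact_pi_neq0 (xa i).
exists x; first by split=> // -[i xi]; case/eqP: (x0 i).
by apply/ffunP => i; apply: exact_uniq (valE _ x0 i) (xa i).
Qed.

Lemma exact_le i n m x : exact i n x -> ge i m x -> m <= n.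
Proof.
move=> xn xm; rewrite leNgt; apply/negP => lt_nm.
by apply: (exact_not_ge xn); apply: ge_le xm; lia.
Qed.

Lemma T_add a x y : T a x -> T a y -> T a (x + y).
Proof. by move=> Tx Ty i; apply: geD. Qed.

Lemma T_scale a c x : T a x -> T a (c *: x).
Proof. by move=> Tx i; apply: geZ. Qed.

Lemma T_mul a b x y : T a x -> T b y -> T (a + b) (x * y).
Proof. by move=> Tx Ty i; rewrite ffunE; apply: geM. Qed.

Lemma T_le a b x : le_vec a b -> T b x -> T a x.
Proof. by move=> le_ab Tx i; apply: ge_le (le_ab i) (Tx i). Qed.

Lemma T0 a : T a 0.
Proof. by move=> i; apply: ge_other; rewrite rmorph0. Qed.

Lemma T_unitv a i x : T (a + unitv i) x <-> T a x /\ ge i (a i + 1) x.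
Proof.
split=> [Tx|[Tx gx] j].
  split=> [|]; last by have := Tx i; rewrite !ffunE eqxx.
  by apply: T_le Tx => j; rewrite !ffunE lerDl ler0n.
by rewrite !ffunE; case: eqP => [->|_]; rewrite ?addr0.
Qed.

Definition jump i (A : set K) a : Prop :=
  exists x, [/\ A x, T a x & exact i (a i) x].

Lemma subspace_T a : subspace (T a).
Proof. by split; [exact: T0|exact: T_add|exact: T_scale]. Qed.

Lemma ge_lead i n x y : ge i n x -> exact i n y ->
  exists c, ge i (n + 1) (x - c *: y).
Proof.
move=> [c xc] [d d0 yd]; exists (c / d); apply/lterm0P.
rewrite -scaleNr (_ : 0 = c + - (c / d) * d); last first.
  by rewrite mulNr divfK ?subrr.
exact/ltermD/ltermZ.
Qed.

(** The coefficient of [t_i ^ (a i)] is a linear form on [A `&` T a] with kernel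
    [A `&` T (a + unitv i)]: the quotient is at most a line. *)
Lemma jump_decomp A i a x0 x : subspace A -> A x0 -> T a x0 ->
  exact i (a i) x0 -> (A `&` T a) x ->
  exists c, (A `&` T (a + unitv i)) (x - c *: x0).
Proof.
move=> sA Ax0 Tx0 x0i [Ax Tx]; have [c gc] := ge_lead (Tx i) x0i.
exists c; split; first by apply: subspaceB => //; have [_ _] := sA; apply.
apply/T_unitv; split=> //.
by apply: (subspaceB (subspace_T a)) => //; apply: T_scale.
Qed.

Lemma no_jump A i a : ~ jump i A a -> A `&` T (a + unitv i) = A `&` T a.
Proof.
move=> nj; apply/seteqP; split=> x [Ax Tx]; split=> //.
  by case/T_unitv: Tx.
apply/T_unitv; split=> //; have [xi|//] := ge_exact (Tx i).
by case: nj; exists x.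
Qed.

(** Since [k] is infinite, finitely many leading coefficients can be kept
    nonzero at once by a linear combination. *)
Lemma generic_exact A a (s : seq 'I_r) : subspace A ->
    (forall i, i \in s -> jump i A a) ->
  exists x, [/\ A x, T a x & forall i, i \in s -> exact i (a i) x].
Proof.
move=> sA; have [A0 AD AZ] := sA; elim: s => [|j s IHs] js.
  by exists 0; split=> //; exact: T0.
have [i i_s|x [Ax Tx xs]] := IHs; first by apply: js; rewrite inE i_s orbT.
have [y [Ay Ty yj]] := js j (mem_head j s).
have /choice[c xc] := Tx; have /choice[d yd] := Ty.
(* The scalars in the list are those for which the leading coefficient of
   [x + e *: y] may vanish at some [i]. *)
have [e e_bad] := closed_field_infinite [seq - c i / d i | i <- j :: s].
exists (x + e *: y); split; [exact/AD/AZ|exact/T_add/T_scale|].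
move=> i i_js; exists (c i + e * d i); last exact/ltermD/ltermZ.
apply: contraNneq e_bad => /eqP; rewrite addrC addr_eq0 => /eqP ed.
have [d0|d0] := eqVneq (d i) 0; last first.
  apply/mapP; exists i => //; apply: (mulIf d0).
  by rewrite ed divfK.
move: i_js; rewrite inE => /predU1P[ij|/xs[c' c'0 xc']].
  case/exact_not_ge: yj; apply/lterm0P; rewrite -ij -d0; exact: yd.
case/eqP: c'0; rewrite (lterm_uniq xc' (xc i)).
by apply/eqP; rewrite -oppr_eq0 -ed d0 mulr0.
Qed.

(** Zero components are harmless when [A] contains all elements of large order:
    they can be replaced by high powers of [t_i]. *)
Lemma fiber_jumpP A N J a : subspace A -> T N `<=` A ->
  fiber J (value_set pi tau A) a !=set0 <->
  forall i, i \in J -> jump i A (a + off J).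
Proof.
move=> sA TA; split=> [[b [/value_setP[x Ax xb] bJ bJc]] i iJ|jJ].
  exists x; split=> //; last first.
    by rewrite !ffunE iJ addr0 -(bJ i iJ).
  move=> j; apply: ge_le (exact_ge (xb j)); rewrite !ffunE.
  case: (boolP (j \in J)) => [/bJ ->|/bJc /=]; rewrite ?addr0 //; lia.
have [|x [Ax Tx xJ]] := @generic_exact A (a + off J) (enum J) sA.
  by move=> i; rewrite mem_enum; apply: jJ.
pose n i := Num.max (N i) (a i + 1).
have [y [yE _]] := branch_prod hbr
  (fun i => if pi i x == 0 then tau i fpsX ^ n i else pi i x).
have Ay : A y.
  rewrite -[y](subrK x); have [_ AD _] := sA; apply: AD => //; apply: TA => i.
  have [x0|x0] := eqVneq (pi i x) 0; last first.
    by apply: ge_other; rewrite rmorphB yE (negPf x0) subrr.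
  apply: (ge_le (n := n i)); first by rewrite /n; lia.
  exists 1, 1; first by rewrite fps_coef1.
  by rewrite rmorphB yE x0 eqxx subr0 rmorph1 mul1r.
have y0 i : pi i y != 0.
  by rewrite yE; case: ifPn => // _; apply: tauX_unit.
have Ty : T (a + off J) y.
  move=> i; have [x0|x0] := eqVneq (pi i x) 0.
    apply: (ge_le (n := n i)); first by rewrite /n !ffunE; case: (i \in J) => /=; lia.
    exists 1, 1; first by rewrite fps_coef1.
    by rewrite yE x0 eqxx rmorph1 mul1r.
  have [c [f fc Ef]] := Tx i; exists c, f => //.
  by rewrite yE (negPf x0).
have yJ i : i \in J -> exact i (a i) y.
  move=> iJ; have := xJ i; rewrite mem_enum => /(_ iJ) xi.
  have x0 := exact_pi_neq0 xi; move: xi; rewrite !ffunE iJ addr0 => -[c c0].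
  by move=> [f fc Ef]; exists c => //; exists f; rewrite // yE (negPf x0).
have [b yb] := choice (fun i => exact_neq0 (y0 i)).
exists [ffun i => b i]; split.
- by apply/value_setP; exists y => // i; rewrite ffunE.
- by move=> i iJ; rewrite ffunE; apply: exact_uniq (yb i) (yJ i iJ).
- move=> i iJ; rewrite ffunE; have := exact_le (yb i) (Ty i).
  by rewrite !ffunE iJ /=; lia.
Qed.

Lemma lterm_one i : lterm i 0 1 1.
Proof.
exists 1; first by rewrite fps_coef1.
by rewrite !rmorph1 expr0z mulr1.
Qed.

Lemma exact_one i : exact i 0 1.
Proof. by exists 1; [exact: oner_neq0|exact: lterm_one]. Qed.

(** * The ring and its conductor *)

Local Notation ringO := (range iota).

Lemma range_iota w : ringO (iota w). Proof. by exists w. Qed.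

Lemma subspace_ringO : subspace ringO.
Proof.
split=> [|_ _ [v _ <-] [w _ <-]|c _ [v _ <-]].
- by exists 0; rewrite ?rmorph0.
- by exists (v + w); rewrite ?rmorphD.
- by exists (c *: v); rewrite ?linearZ.
Qed.

Lemma ringO_mul x y : ringO x -> ringO y -> ringO (x * y).
Proof. by move=> [v _ <-] [w _ <-]; exists (v * w); rewrite ?rmorphM. Qed.

Lemma ringO_T0 : ringO `<=` T 0.
Proof. by rewrite -integral_closureE => _ [w _ <-]; apply: integral_id. Qed.

Lemma conductor_ideal_sub : conductor_ideal iota `<=` ringO.
Proof.
move=> h Ch; rewrite -[h]mulr1; apply: Ch.
by rewrite integral_closureE => i; rewrite ffunE; apply: exact_ge (exact_one i).
Qed.

Lemma T_sub_conductor a : T a `<=` ringO -> T a `<=` conductor_ideal iota.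
Proof.
move=> TO x Tx y; rewrite integral_closureE => Ty; apply: TO.
by rewrite -[a]addr0; apply: T_mul.
Qed.

Lemma subspace_conductor : subspace (conductor_ideal iota).
Proof.
have [O0 OD OZ] := subspace_ringO.
split=> [z _|x y Cx Cy z Tz|c x Cx z Tz].
- by rewrite mul0r.
- by rewrite mulrDl; apply: OD; [apply: Cx|apply: Cy].
- by rewrite -scalerAl; apply/OZ/Cx.
Qed.

Lemma conductor_mul x y : T 0 x -> conductor_ideal iota y ->
  conductor_ideal iota (x * y).
Proof.
move=> Tx Cy z; rewrite mulrAC mulrC integral_closureE => Tz; apply: Cy.
by rewrite integral_closureE -[0]addr0; apply: T_mul.
Qed.

Hypothesis hK : total_ring_of_fractions iota.

(** The normalization is spanned over [ringO] by finitely many fractions; a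
    common denominator of them lies in the conductor. *)
Lemma conductor_contains_T (n : nat) :
    quot_dim (integral_closure iota) ringO n ->
  exists b, T b `<=` conductor_ideal iota.
Proof.
move=> [e [_ eP]]; have [_ hreg hfrac] := hK.
have /choice[q qP] (j : 'I_n) : exists q, iota q \is a GRing.unit /\ ringO (iota q * e j).
  have [p [q [q_reg Ee]]] := hfrac (e j); have qu := hreg q q_reg.
  exists q; split=> //; rewrite Ee mulrC divrK //; exact: range_iota.
pose d := \prod_(j < n) q j.
have du : iota d \is a GRing.unit.
  by rewrite rmorph_prod; apply: rpred_prod => j _; case: (qP j).
have de (j : 'I_n) : ringO (iota d * e j).
  rewrite /d (bigD1 j) //= rmorphM mulrAC; apply: ringO_mul.
    by case: (qP j).
  exact: range_iota.
have dO x : T 0 x -> ringO (iota d * x).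
  rewrite -integral_closureE => /eP[c [[w _ Ew] _]].
  have [_ OD OZ] := subspace_ringO.
  rewrite -[x](subrK (\sum_(i < n) c i *: e i)) -Ew mulrDr; apply: OD.
    by apply: ringO_mul; apply: range_iota.
  rewrite mulr_sumr; apply: subspace_sum; first exact: subspace_ringO.
  by move=> i; rewrite -scalerAr; apply: OZ.
have [b Tb] := T_bounded (iota d)^-1.
exists (- b) => y Ty x; rewrite integral_closureE => Tx.
have -> : y * x = iota d * ((iota d)^-1 * y * x) by rewrite !mulrA divrr ?mul1r.
by apply: dO; rewrite -[0]addr0 -{1}(subrr b); do 2?apply: T_mul.
Qed.

Lemma T_sub_le a b : T a `<=` T b -> le_vec b a.
Proof.
move=> Tab i; apply: (exact_le (exact_tpow i (a i))).
by apply: Tab; apply: T_tpow.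
Qed.

(** [T a] is the sum of [T (a + unitv i)] and the line spanned by any element of
    [T a] of exact order [a i] at [i]. *)
Lemma T_jump A a i : subspace A -> jump i A a -> T (a + unitv i) `<=` A ->
  T a `<=` A.
Proof.
move=> sA [x0 [Ax0 Tx0 x0i]] TA x Tx; have [c gc] := ge_lead (Tx i) x0i.
have [_ AD AZ] := sA; rewrite -[x](subrK (c *: x0)); apply: AD; last exact: AZ.
apply: TA; apply/T_unitv; split=> //.
by apply: (subspaceB (subspace_T a)) => //; apply: T_scale.
Qed.

(** Among the [T b] inside the conductor ideal, take [T c] with [c] of least
    weight. An element of the conductor ideal outside [T c] has too small an order
    at some [i]; isolating its [i]-th component, which is allowed in an ideal of
    the normalization, puts [T (c - unitv i)] inside as well. *)
Lemma conductor_eq_T (n : nat) : quot_dim (integral_closure iota) ringO n ->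
  exists c : vec, conductor_ideal iota = T c.
Proof.
move=> /conductor_contains_T[b0 Tb0].
have T_ge0 b : T b `<=` conductor_ideal iota -> le_vec 0 b.
  by move=> TC; apply: T_sub_le => x /TC/conductor_ideal_sub/ringO_T0.
pose Q (w : nat) := `[< exists2 b, T b `<=` conductor_ideal iota & \sum_i b i = w%:Z >].
have exQ : exists w, Q w.
  exists `|(\sum_i b0 i)%R|%N; apply/asboolP; exists b0 => //.
  rewrite gez0_abs // sumr_ge0 // => i _.
  by have := T_ge0 _ Tb0 i; rewrite ffunE.
have [m /asboolP[c Tc Ec] m_min] := ex_minnP exQ; exists c.
apply/seteqP; split=> // x Cx i; apply: contrapT => ngx.
have x0 : pi i x != 0 by apply/eqP => /ge_other gx; apply: ngx.
have [p xp] := exact_neq0 x0.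
have lt_pc : p < c i.
  by rewrite ltNge; apply/negP => le_cp; apply/ngx/(ge_le le_cp)/exact_ge.
have Tc' : T (c - unitv i) `<=` conductor_ideal iota.
  apply: (@T_jump _ _ i) subspace_conductor _ _; last by rewrite subrK.
  have ci : (c - unitv i) i = c i - 1 - p + p by rewrite !ffunE eqxx subrK.
  exists (tpow i (c i - 1 - p) * x); split.
  - apply: conductor_mul => //; apply: T_tpow; rewrite ffunE; lia.
  - move=> j; have [->|ji] := eqVneq j i.
      by rewrite ci; apply: geM (exact_ge (exact_tpow _ _)) (exact_ge xp).
    by apply: ge_other; rewrite rmorphM tpow_other ?mul0r.
  - by rewrite ci; apply: exactM xp; apply: exact_tpow.
have sum' : \sum_j (c - unitv i) j = m%:Z - 1.
  under eq_bigr => j _ do rewrite !ffunE.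
  rewrite sumrB Ec (bigD1 i) //= eqxx big1 ?addr0 // => j /negPf -> //.
have sum_ge0 : 0 <= \sum_j (c - unitv i) j.
  by apply: sumr_ge0 => j _; have := T_ge0 _ Tc' j; rewrite [X in X <= _]ffunE.
have /m_min : Q m.-1 by apply/asboolP; exists (c - unitv i) => //; rewrite sum'; lia.
by lia.
Qed.

Section Conductor.
Variable c : vec.
Hypothesis cE : conductor_ideal iota = T c.

Lemma T_conductor : T c `<=` ringO.
Proof. by rewrite -cE; apply: conductor_ideal_sub. Qed.

Lemma conductor_le a : T a `<=` ringO -> le_vec c a.
Proof. by move=> /T_sub_conductor; rewrite cE => /T_sub_le. Qed.

Lemma conductor_ge0 : le_vec 0 c.
Proof. by apply: T_sub_le => x /T_conductor/ringO_T0. Qed.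

(** Such a jump would put [T (c - unitv i)] inside [ringO], against the
    minimality of [c]. *)
Lemma no_jump_conductor i : ~ jump i ringO (c - unitv i).
Proof.
move=> /(T_jump subspace_ringO); rewrite subrK => /(_ T_conductor)/conductor_le.
by move=> /(_ i); rewrite !ffunE eqxx /=; lia.
Qed.

Lemma exact_vec a : exists x, forall i, exact i (a i) x.
Proof.
have [x [xE _]] := branch_prod hbr (fun i => tau i fpsX ^ a i).
exists x => i; exists 1; first exact: oner_neq0.
by exists 1; [rewrite fps_coef1|rewrite xE rmorph1 mul1r].
Qed.

(** If all vectors above [a] are values, then [T a] lies in [ringO]: descending
    from a vector above both [a] and [c], each unit step is a jump. *)
Lemma conductor_valueE : conductor (value_set pi tau ringO) = c.
Proof.
set S := value_set pi tau ringO.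
have Sc a : le_vec c a -> S a.
  move=> le_ca; have [x xa] := exact_vec a; apply/value_setP; exists x => //.
  by apply: T_conductor => i; apply: ge_le (le_ca i) (exact_ge (xa i)).
have c_bound : conductor_bound S c by split=> //; apply: Sc; apply: le_vec_refl.
have c_least a : conductor_bound S a -> le_vec c a.
  move=> [_ Sa]; apply: conductor_le.
  have [u [le_au le_cu]] := vec_upper a c.
  suff : le_vec a a -> T a `<=` ringO by apply; apply: le_vec_refl.
  apply: (@vec_ind_down _ (fun b => le_vec a b -> T b `<=` ringO) u) => //.
    by move=> _ x Tx; apply: T_conductor; apply: T_le le_cu Tx.
  move=> b i _ IHb le_ab; apply: (@T_jump _ _ i) subspace_ringO _ _; last first.
    rewrite subrK; apply: IHb; apply: le_vec_trans le_ab _ => j.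
    by rewrite !ffunE lerBlDr lerDl ler0n.
  have /value_setP[x Ox xb] := Sa _ le_ab; exists x; split=> // j.
  exact: exact_ge (xb j).
rewrite /conductor; case: xgetP => [a _ [a_bound a_least]|/(_ c)[]//].
by apply/ffunP => i; apply/eqP; rewrite eq_le a_least ?c_least.
Qed.

(** * Symmetry of the ring *)

(** The product of two elements responsible for these jumps would be responsible
    for a jump of [ringO] at [c - unitv i]. *)
Lemma pairing_jump A B a i : (forall x y, A x -> B y -> ringO (x * y)) ->
  jump i A a -> ~ jump i B (c - a - unitv i).
Proof.
move=> AB [x [Ax Tx xi]] [y [By Ty yi]]; apply: (no_jump_conductor (i := i)).
have E : a + (c - a - unitv i) = c - unitv i.
  by apply/ffunP => j; rewrite !ffunE; ring.
exists (x * y); split; first exact: AB.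
  by rewrite -E; apply: T_mul.
by rewrite -E ffunE; apply: exactM.
Qed.

Definition jumpb i A a : bool := `[< jump i A a >].

Lemma jump_quot_dim A B i a (m : nat) : subspace B -> B `<=` A ->
  quot_dim A (B `&` T a) m ->
  quot_dim A (B `&` T (a + unitv i)) (m + jumpb i B a).
Proof.
move=> sB BA; rewrite /jumpb; case: asboolP => [[x0 [Bx0 Tx0 x0i]]|nj] /=.
  rewrite addn1; apply: (quot_dim_step (x0 := x0)); rewrite //.
  - exact/subspaceI/subspace_T.
  - exact/subspaceI/subspace_T.
  - by move=> x [Bx /T_unitv[]].
  - exact: BA.
  - move=> [_ /T_unitv[_ gx]]; exact: exact_not_ge x0i gx.
  - by move=> x; apply: jump_decomp.
by rewrite addn0 no_jump.
Qed.

Definition weight a : int := \sum_i a i.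

Lemma weight_unitv a i : weight (a + unitv i) = weight a + 1.
Proof.
rewrite /weight; under eq_bigr => j _ do rewrite !ffunE.
rewrite big_split /=; congr (_ + _); rewrite (bigD1 i) //= eqxx big1 ?addr0 //.
by move=> j /negPf ->.
Qed.

Lemma weightB a b : weight (a - b) = weight a - weight b.
Proof. by rewrite /weight -sumrB; apply: eq_bigr => i _; rewrite !ffunE. Qed.

Lemma quot_dim_T a : le_vec 0 a ->
  exists2 m : nat, m%:Z = weight a & quot_dim (T 0) (T a) m.
Proof.
have TI b : le_vec 0 b -> T 0 `&` T b = T b.
  by move=> le_0b; rewrite setIidr // => x; apply: T_le.
move: a; apply: vec_ind => [|b i le_0b [m Em dm]].
  exists 0; last exact: quot_dim_refl.
  by rewrite /weight big1 // => i _; rewrite ffunE.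
exists (m + jumpb i (T 0) b); last first.
  rewrite -(TI (b + unitv i)); last first.
    by move=> j; have := le_0b j; rewrite !ffunE => b0; rewrite addr_ge0.
  by apply: jump_quot_dim; rewrite ?TI //; apply: subspace_T.
rewrite weight_unitv -Em /jumpb asboolT ?PoszD //.
exists (tpow i (b i)); split; [|exact: T_tpow|exact: exact_tpow].
by apply: T_tpow; apply: le_0b.
Qed.

Section Symmetry.
Variable n : nat.
Hypothesis dim_conductor : quot_dim ringO (conductor_ideal iota) n.
Hypothesis dim_closure : quot_dim (integral_closure iota) ringO n.

Lemma colength_exists a : exists m : nat,
  quot_dim ringO (ringO `&` T a) m /\ quot_dim (T 0) (ringO `&` T a) (n + m).
Proof.
have [l [le_la le_l0]] := vec_lower a 0; move: a le_la; apply: vec_ind.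
  have -> : ringO `&` T l = ringO.
    by rewrite setIidl // => x /ringO_T0; apply: T_le.
  exists 0; split; first exact: quot_dim_refl.
  by rewrite addn0 -integral_closureE.
move=> a i _ [m [dm dnm]]; exists (m + jumpb i ringO a); split.
  by apply: jump_quot_dim => //; exact: subspace_ringO.
rewrite addnA; apply: jump_quot_dim => //; first exact: subspace_ringO.
exact: ringO_T0.
Qed.

(** Writing [l a] for the colength of [ringO `&` T a], the function
    [l a - l (c - a) - weight a] can only decrease with [a], because at most one
    of [a] and [c - a - unitv i] is a jump. The Gorenstein condition says that it
    takes the same value for very small and very large [a]; hence it is
    constant, and exactly one of them is a jump. *)
Lemma symmetry_ringO a i :
  jump i ringO a \/ jump i ringO (c - a - unitv i).
Proof.
apply: contrapT => /not_orP[nj nj'].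
have /choice[l lP] := colength_exists.
have sI b : subspace (ringO `&` T b).
  by apply: subspaceI; [exact: subspace_ringO|exact: subspace_T].
have l_uniq b (m : nat) : quot_dim ringO (ringO `&` T b) m -> l b = m.
  by case: (lP b) => dl _; apply: quot_dim_uniq.
have l_step b j : l (b + unitv j) = (l b + jumpb j ringO b)%N.
  apply/l_uniq/jump_quot_dim => //; first exact: subspace_ringO.
  by case: (lP b).
have l_low b : le_vec b 0 -> l b = 0%N.
  move=> b0; apply: l_uniq; rewrite setIidl; first exact: quot_dim_refl.
  by move=> x /ringO_T0; apply: T_le.
have l_high b : le_vec c b -> (n + l b)%:Z = weight b.
  move=> le_cb; have le0b := le_vec_trans conductor_ge0 le_cb.
  have [m <- dm] := quot_dim_T le0b; congr Posz.
  have [_] := lP b; rewrite setIidr; last first.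
    by move=> x /(T_le le_cb)/T_conductor.
  by move=> dl; apply: quot_dim_uniq dl dm; apply: subspace_T.
have n_c : weight c = (n + n)%:Z.
  rewrite -l_high; last exact: le_vec_refl.
  congr (Posz (n + _)); apply: l_uniq.
  rewrite setIidr; last exact: T_conductor.
  by rewrite -cE.
pose h b : int := (l b)%:Z - (l (c - b))%:Z - weight b.
have h_step b j :
    h (b + unitv j) = h b - 1 +
      ((jumpb j ringO b : nat)%:Z + (jumpb j ringO (c - b - unitv j) : nat)%:Z).
  have := l_step (c - b - unitv j) j; rewrite subrK => l_dual.
  rewrite /h weight_unitv l_step opprD [c + _]addrA l_dual !PoszD; ring.
have h_le b b' : le_vec b b' -> h b' <= h b.
  apply: (@vec_ind _ (fun b' => h b' <= h b)) => // {}b' j _; apply: le_trans.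
  rewrite h_step; have := @pairing_jump ringO ringO b' j ringO_mul.
  rewrite /jumpb; case: asboolP; case: asboolP => // j1 j2; try lia.
  by move=> /(_ j2).
have [lo [lo_a lo_0]] := vec_lower a 0.
have [hi [hi_a hi_c]] := vec_upper (a + unitv i) c.
have h_lo : h lo = - n%:Z.
  have le_c : le_vec c (c - lo).
    by move=> j; have := lo_0 j; rewrite !ffunE lerBrDl gerDr.
  by have := l_high _ le_c; rewrite /h (l_low lo) // weightB n_c; lia.
have h_hi : h hi = - n%:Z.
  rewrite /h -(l_high hi) // (l_low (c - hi)); first by lia.
  by move=> j; have := hi_c j; rewrite !ffunE subr_le0.
have := h_le _ _ lo_a; have := h_le _ _ hi_a.
by rewrite h_step /jumpb !asboolF // h_lo h_hi; lia.
Qed.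

(** * The socle of the quotient of K by the ring *)

Hypothesis hO : algebroid_curve O.

Lemma unit_T0 w b : w \is a GRing.unit -> T b (iota w) -> le_vec b 0.
Proof.
move=> wu Tw i; rewrite ffunE; apply: (exact_le (exact_one i)).
rewrite -(rmorph1 iota) -(divrr wu) rmorphM -[b]addr0.
exact: (T_mul Tw (ringO_T0 (range_iota _)) i).
Qed.

(** If the constant term [d] of a non-unit [w] along the branch [i] were nonzero,
    then [w - d%:A] would be a unit, because [O] is local, although its constant
    term along [i] is zero. *)
Lemma nonunit_ge i w : w \isn't a GRing.unit -> ge i 1 (iota w).
Proof.
move=> wn; have Tw := ringO_T0 (range_iota w) i; rewrite ffunE in Tw.
have [[d d0 wd]|] := ge_exact Tw; last by rewrite add0r.
have u_unit : w - d%:A \is a GRing.unit.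
  apply: contraT => un; have dn : - (w - d%:A) + w \isn't a GRing.unit.
    by apply: (algebroid_local hO) => //; rewrite unitrN.
  by rewrite opprB subrK scaler_unit ?unitfE // unitr1 in dn.
have ui : ge i 1 (iota (w - d%:A)).
  rewrite -[1]add0r; apply/lterm0P; rewrite linearB linearZ /= rmorph1 -scaleNr.
  rewrite -(subrr d) -[in X in d - X](mulr1 d) -mulNr.
  by apply: ltermD => //; apply: ltermZ; apply: lterm_one.
have : T (unitv i) (iota (w - d%:A)).
  move=> j; rewrite ffunE; case: eqP => [-> //|_].
  by have := ringO_T0 (range_iota (w - d%:A)) j; rewrite ffunE.
by move=> /(unit_T0 u_unit)/(_ i); rewrite !ffunE eqxx.
Qed.

(** Modulo [T c], only the coefficient of [t_i ^ (c i - 1)] of [x] survives. *)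
Lemma T_corner a i x y : (forall j, j != i -> c j <= a j) -> c i - 1 <= a i ->
    T a x -> exact i (c i - 1) y -> (forall j, j != i -> ge j (c j) y) ->
  exists d, ringO (x - d *: y).
Proof.
move=> a_i ai Tx yi yj; have [d gd] := ge_lead (ge_le ai (Tx i)) yi.
exists d; apply: T_conductor => j.
have [->|ji] := eqVneq j i; first by rewrite subrK in gd.
apply: geD; first exact: ge_le (a_i j ji) (Tx j).
by rewrite -scaleNr; apply: geZ; apply: yj.
Qed.

Local Notation corner i := (tpow i (c i - 1)).

(** Multiplication by non-units sends [z] into [ringO]. The order of [z] is
    increased by subtracting elements of [ringO] until symmetry provides an
    element [w] of [ringO] with [z * w] outside [ringO]; then [w] is a unit, which
    leaves only one place for [z]. *)
Lemma socle_corner z : (forall w, w \isn't a GRing.unit -> ringO (z * iota w)) ->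
  ringO z \/ exists i d, ringO (z - d *: corner i).
Proof.
move=> zO; apply: contrapT => /not_orP[nz no_corner].
have [_ OD OZ] := subspace_ringO.
have [a Tz] := T_bounded z; have [u [le_au le_cu]] := vec_upper a c.
suff [x Ox Tzx] : exists2 x, ringO x & T u (z - x).
  apply: nz; rewrite -[z](subrK x); apply: OD => //.
  by apply: T_conductor; apply: T_le Tzx.
move: u le_au {le_cu}; apply: vec_ind => [|b i _ [x Ox Tzx]].
  by exists 0; [case: subspace_ringO|rewrite subr0].
have [zxi|gzx] := ge_exact (Tzx i); last by exists x => //; apply/T_unitv.
have [[x1 [Ox1 Tx1 x1i]]|[_ [[w _ <-] Tw wi]]] := symmetry_ringO b i.
  have [d gd] := ge_lead (exact_ge zxi) x1i.
  exists (x + d *: x1); first exact/OD/OZ.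
  rewrite opprD addrA; apply/T_unitv; split=> //.
  by apply: (subspaceB (subspace_T b)) => //; apply: T_scale.
have [wu|wn] := boolP (w \is a GRing.unit); last first.
  case: (@pairing_jump [set z - x] [set iota w] b i) => [_ _ -> ->||].
  - rewrite mulrBl; apply: (subspaceB subspace_ringO); first exact: zO.
    by apply: ringO_mul => //; apply: range_iota.
  - by exists (z - x).
  - by exists (iota w).
have le_cb := unit_T0 wu Tw.
case: no_corner; exists i.
have [|||||d Od] := @T_corner b i (z - x) (corner i).
- by move=> j /negPf ji; have := le_cb j; rewrite !ffunE ji /=; lia.
- by have := le_cb i; rewrite !ffunE eqxx /=; lia.
- by [].
- exact: exact_tpow.
- by move=> j ji; apply/ge_other/tpow_other.
exists d; rewrite -[z](subrK x) addrAC; exact: OD.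
Qed.

(** The corners at two branches are proportional modulo [ringO]: as [ringO] is
    local, [unitv j] is not a jump at [i], so its mirror image is one. *)
Lemma corner_corner i j : exists d, ringO (corner i - d *: corner j).
Proof.
have [O0 OD OZ] := subspace_ringO.
have [->|ij] := eqVneq i j; first by exists 1; rewrite scale1r subrr.
have [[_ [[w _ <-] Tw wi]]|[x [Ox Tx xi]]] := symmetry_ringO (unitv j) i.
  have [wu|wn] := boolP (w \is a GRing.unit).
    by have := unit_T0 wu Tw j; rewrite !ffunE eqxx.
  case: (exact_not_ge wi); rewrite ffunE (negPf ij) add0r; exact: nonunit_ge.
have ci : (c - unitv j - unitv i) i = c i - 1.
  by rewrite !ffunE eqxx (negPf ij) subr0.
have [d1 g1] : exists d, ge i (c i - 1 + 1) (corner i - d *: x).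
  by apply: ge_lead; [apply/exact_ge/exact_tpow|rewrite -ci].
have T1 : T (c - unitv j) (corner i - d1 *: x).
  have -> : c - unitv j = (c - unitv j - unitv i) + unitv i by rewrite subrK.
  apply/T_unitv; rewrite ci; split=> //.
  apply: (subspaceB (subspace_T _)); last exact: T_scale.
  by apply: T_tpow; rewrite ci.
have [|||||d Od] := @T_corner (c - unitv j) j (corner i - d1 *: x) (corner j).
- by move=> p /negPf pj; rewrite !ffunE pj subr0.
- by rewrite !ffunE eqxx.
- by [].
- exact: exact_tpow.
- by move=> p pj; apply/ge_other/tpow_other.
exists d; rewrite -[corner i](subrK (d1 *: x)) addrAC.
by apply: OD => //; apply: OZ.
Qed.

Lemma socle_line z j s : (forall w, w \isn't a GRing.unit -> ringO (z * iota w)) ->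
    exact j (c j - 1) s -> (forall i, i != j -> pi i s = 0) ->
  exists d, ringO (z - d *: s).
Proof.
move=> zO sj s0; have [O0 OD OZ] := subspace_ringO.
have [Oz|[i [d1 Od1]]] := socle_corner zO.
  by exists 0; rewrite scale0r subr0.
have [d2 Od2] := corner_corner i j.
have [d3 Od3] : exists d, ringO (corner j - d *: s).
  apply: (@T_corner (c - unitv j) j) => //.
  - by move=> p /negPf pj; rewrite !ffunE pj subr0.
  - by rewrite !ffunE eqxx.
  - by apply: T_tpow; rewrite !ffunE eqxx.
  - by move=> p pj; apply/ge_other/s0.
exists (d1 * d2 * d3).
have -> : z - (d1 * d2 * d3) *: s = z - d1 *: corner i +
    d1 *: (corner i - d2 *: corner j) + (d1 * d2) *: (corner j - d3 *: s).
  by rewrite !scalerBr !scalerA !addrA !subrK.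
by apply: (OD); [apply: (OD) => //|]; apply: OZ.
Qed.

(** * Duality of jumps *)

(** A multiplier [y] of [I] is obtained by descending from [I `&` T a] to larger
    and larger submodules [I `&` T b]: each time one more element [x0] has to be
    multiplied into [ringO]; non-units already bring [y * x0] into [ringO], so
    that by [socle_line] it is enough to correct [y] by a multiple of a power of
    [t_j], too large to disturb what has been achieved. *)
Lemma dual_jump (I : set K) N a i : subspace I ->
    (forall w x, I x -> I (iota w * x)) -> I `<=` T N ->
  ~ jump i I a -> jump i (dual_ideal iota I) (c - a - unitv i).
Proof.
move=> sI IO IN nj; have [_ OD OZ] := subspace_ringO.
pose P b := exists y, [/\ T (c - a - unitv i) y,
  exact i ((c - a - unitv i) i) y & forall x, I x -> T b x -> ringO (y * x)].
suff P_low b : le_vec b a -> P b.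
  have [l [le_la le_lN]] := vec_lower a N; have [y [Ty yi yI]] := P_low l le_la.
  exists y; split=> // x Ix; apply: yI => //; apply: T_le le_lN _; exact: IN.
apply: (@vec_ind_down _ P a) => [|{}b j le_ba [y [Ty yi yI]]].
  exists (tpow i ((c - a - unitv i) i)); split.
  - exact: T_tpow.
  - exact: exact_tpow.
  move=> x Ix Tx; apply: T_conductor => j.
  have [->|ji] := eqVneq j i; last first.
    by apply: ge_other; rewrite rmorphM tpow_other ?mul0r.
  have [xi|gx] := ge_exact (Tx i); first by case: nj; exists x.
  have -> : c i = (c - a - unitv i) i + (a i + 1) by rewrite !ffunE eqxx /=; ring.
  by apply: geM gx; apply/exact_ge/exact_tpow.
have [[x0 [Ix0 Tx0 x0j]]|nj'] := pselect (jump j I (b - unitv j)); last first.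
  exists y; split=> // x Ix Tx; apply: yI => //.
  have : (I `&` T (b - unitv j)) x by [].
  by rewrite -(no_jump nj') subrK => -[].
have [w wn|||d Od] := @socle_line (y * x0) j (tpow j (c j - b j) * x0).
- rewrite -mulrA; apply: yI; first by rewrite mulrC; apply: IO.
  have -> : b = b - unitv j + unitv j by rewrite subrK.
  apply/T_unitv; split.
    rewrite -[b - _]addr0; apply: T_mul => //; exact: ringO_T0 (range_iota _).
  by apply: geM (exact_ge x0j) _; apply: nonunit_ge.
- have -> : c j - 1 = c j - b j + (b - unitv j) j by rewrite !ffunE eqxx /=; ring.
  by apply: exactM x0j; apply: exact_tpow.
- by move=> p pj; rewrite rmorphM tpow_other ?mul0r.
have T_corr : T (c - b) (tpow j (c j - b j)) by apply: T_tpow; rewrite !ffunE.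
exists (y - d *: tpow j (c j - b j)); split.
- apply: (subspaceB (subspace_T _)) => //; apply: T_scale; apply: T_le T_corr.
  by move=> p; have := le_ba p; rewrite !ffunE; case: (p == i) => /=; lia.
- apply: exactDr => //; rewrite -scaleNr; apply: geZ; apply: ge_le (T_corr i).
  by have := le_ba i; rewrite !ffunE eqxx /=; lia.
move=> x Ix Tx; have [e [Ie Te]] := jump_decomp sI Ix0 Tx0 x0j (conj Ix Tx).
rewrite subrK in Te; rewrite -[x](subrK (e *: x0)) mulrDr; apply: OD; last first.
  by rewrite -scalerAr mulrBl -scalerAl; apply: OZ.
rewrite mulrBl; apply: (subspaceB subspace_ringO); first exact: yI.
rewrite -scalerAl; apply/OZ/T_conductor.
by have := T_mul T_corr Te; rewrite subrK.
Qed.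

(** * Fractional ideals and their duals *)

Lemma fractional_subspace (I : set K) : fractional_ideal iota I -> subspace I.
Proof.
move=> [I0 ID IO _ _]; split=> // d x Ix.
by rewrite -mulr_algl -(rmorph_alg iota); apply: IO.
Qed.

Lemma fractional_sub_T (I : set K) : fractional_ideal iota I ->
  exists a, I `<=` T a.
Proof.
move=> [_ _ _ _ [w /(let: And3 _ hreg _ := hK in hreg) wu wI]].
have [a Ta] := T_bounded (iota w)^-1; exists a => x /wI/ringO_T0 Tx.
by rewrite -[x](mulKr wu) -[a]addr0; apply: T_mul.
Qed.

Lemma T_sub_fractional (I : set K) : fractional_ideal iota I ->
  exists a, T a `<=` I.
Proof.
move=> [_ _ IO [w /(let: And3 _ hreg _ := hK in hreg) wu Iw] _].
have [a Ta] := T_bounded (iota w)^-1; exists (c - a) => x Tx.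
have [v _ Ev] : ringO ((iota w)^-1 * x).
  by apply: T_conductor; rewrite -(subrK a c) addrC; apply: T_mul.
by rewrite -[x](mulVKr wu) mulrC -Ev; apply: IO.
Qed.

Lemma subspace_dual (I : set K) : subspace (dual_ideal iota I).
Proof.
have [O0 OD OZ] := subspace_ringO; split=> [y _|x y Dx Dy z Iz|d x Dx z Iz].
- by rewrite mul0r.
- by rewrite mulrDl; apply: OD; [apply: Dx|apply: Dy].
- by rewrite -scalerAl; apply/OZ/Dx.
Qed.

Lemma T_sub_dual (I : set K) a : I `<=` T a -> T (c - a) `<=` dual_ideal iota I.
Proof.
move=> IT x Tx y /IT Ty; apply: T_conductor.
by have := T_mul Tx Ty; rewrite subrK.
Qed.

(** Products exclude a pair of mirror jumps, and [dual_jump] provides one of the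
    two. All that is said about maximals is read off from this equivalence. *)
Lemma jump_dual (I : set K) a i : fractional_ideal iota I ->
  jump i I a <-> ~ jump i (dual_ideal iota I) (c - a - unitv i).
Proof.
move=> fI; split=> [|njd].
  by apply: pairing_jump => x y Ix Dy; rewrite mulrC; apply: Dy.
apply: contrapT => nj; apply: njd; have [b Ib] := fractional_sub_T fI.
by apply: (dual_jump (fractional_subspace fI) _ Ib nj); case: fI.
Qed.

End Symmetry.
End Conductor.

End Branches.

Theorem corollary27 (k : closedFieldType) (O : comUnitAlgType k)
    (r : nat) (wp : 'I_r -> set O)
    (K : comUnitAlgType k) (iota : {lrmorphism O -> K})
    (Ki : 'I_r -> fieldType) (pi : forall i, {rmorphism K -> Ki i})
    (tau : forall i, {rmorphism fps k -> Ki i})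
    (hO : algebroid_curve O) (hwp : minimal_primes wp)
    (hK : total_ring_of_fractions iota) (hbr : branches iota wp pi tau)
    (hG : gorenstein iota)
    (I : set K) (hI : fractional_ideal iota I) :
  let S := value_set pi tau (range iota) in
  let E := value_set pi tau I in
  let Estar := value_set pi tau (dual_ideal iota I) in
  let f := frobenius S in
  (forall beta, Estar beta -> (maximal Estar beta <-> E (f - beta))) /\
  (forall alpha beta, Estar beta -> E alpha -> alpha + beta = f ->
    (absolute_maximal E alpha <-> relative_maximal Estar beta)).
Proof.
have [n [dimC dimO]] := hG; have [c cE] := conductor_eq_T hbr hK dimO.
move=> S E Estar f.
have fE : f = c - [ffun=> 1] by rewrite /f /frobenius (conductor_valueE hbr cE).
have [a0 T_I] := T_sub_fractional hbr hK cE hI.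
have [a1 I_T] := fractional_sub_T hbr hK hI.
have fibE : fibers_by_jumps E (fun i => jump pi tau i I).
  by move=> J a; apply: (fiber_jumpP hbr _ _ (fractional_subspace hI) T_I).
have fibF : fibers_by_jumps Estar (fun i => jump pi tau i (dual_ideal iota I)).
  move=> J a; apply: (fiber_jumpP hbr _ _ (subspace_dual iota I)).
  exact: (T_sub_dual hbr cE I_T).
have dual i a : jump pi tau i I a <->
    ~ jump pi tau i (dual_ideal iota I) (c - a - unitv i).
  exact: (jump_dual hbr hK cE dimC dimO hO).
split=> [beta Fb|alpha beta Fb Ea]; rewrite fE.
  exact: (maximal_dual fibE fibF dual).
exact: (absolute_relative_dual fibE fibF dual).
Qed.
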